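(* Let $R$ be a commutative noetherian ring such that $\dim R\le2$, let $\mathfrak a$ and $\mathfrak b$ be ideals of $R$ such that $\mathfrak b\subseteq\mathfrak a$, and let $M$ be a finitely generated $R$-module. Then, for each $n\in\mathbb N$, $$f_{\mathfrak a}^{\mathfrak b}(M)_n\ge\lambda_{\mathfrak a}^{\mathfrak b}(M)_n-1 .$$
   Context: $\mathbb N$ is the set of non-negative integers; $H^i_{\mathfrak a}$ is the $i$-th local cohomology functor with support in $\mathfrak a$; $V(\mathfrak b)$ is the set of primes containing $\mathfrak b$. For ideals $\mathfrak b\subseteq\mathfrak a$ of a commutative noetherian ring $R$ and an $R$-module $M$, set $$\lambda_{\mathfrak a}^{\mathfrak b}(M):=\inf\{\operatorname{depth}M_{\mathfrak p}+\operatorname{ht}((\mathfrak a+\mathfrak p)/\mathfrak p)\mid \mathfrak p\in\operatorname{Spec}R\setminus V(\mathfrak b)\},$$ $$f_{\mathfrak a}^{\mathfrak b}(M)_n:=\inf\{i\in\mathbb N\mid \dim\operatorname{Supp}(\mathfrak b^tH^i_{\mathfrak a}(M))\ge n\text{ for all }t\in\mathbb N\},$$ $$\lambda_{\mathfrak a}^{\mathfrak b}(M)_n:=\inf\{\lambda_{\mathfrak aR_{\mathfrak p}}^{\mathfrak bR_{\mathfrak p}}(M_{\mathfrak p})\mid \mathfrak p\in\operatorname{Spec}R,\ \dim R/\mathfrak p\ge n\},$$ where in the last line $\lambda$ is computed over the local ring $R_{\mathfrak p}$. Here $\operatorname{ht}((\mathfrak a+\mathfrak p)/\mathfrak p)$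 is the height of an ideal of $R/\mathfrak p$. Conventions: $\inf\emptyset=\infty$, the depth of the zero module is $\infty$, the height of the unit ideal is $\infty$, $\dim\emptyset=-\infty$, and $\infty-1=\infty$. *)

(* Defs.v *)
From HB Require Import structures.
From mathcomp Require Import all_boot all_order all_algebra.
From mathcomp Require Import generic_quotient ring_quotient.
From mathcomp Require Import boolp classical_sets constructive_ereal.
From mathcomp Require Import ring.

Set Implicit Arguments.
Unset Strict Implicit.
Unset Printing Implicit Defensive.

Import Order.TTheory GRing.Theory Num.Theory.
Local Open Scope classical_set_scope.
Local Open Scope ring_scope.
Local Open Scope quotient_scope.

(* Dimensions, heights and depths live in \bar int, a complete linear order, so
   the extrema below always exist; inf of the empty set is +oo and sup of the
   empty set is -oo. *)
Definition einf (A : set (\bar int)) : \bar int := infimum +oo%E A.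
Definition esup (A : set (\bar int)) : \bar int := supremum -oo%E A.
Definition enat (n : nat) : \bar int := (n%:Z)%:E.

(** * Submodules, generated submodules, quotients *)

(* The library's submodClosed, as a plain record: unlike the bundled structure
   it is small enough for sets of ideals to be formed. *)
Record submod (R : comPzRingType) (V : lmodType R) := Submod {
  submod_fun : V -> bool;
  submod_funP : submod_closed submod_fun }.
Arguments Submod {R V submod_fun}.

Definition submod_pred (R : comPzRingType) (V : lmodType R) (N : submod V)
  : {pred V} := submod_fun N.
Coercion submod_pred : submod >-> pred_sort.

Definition submodP (R : comPzRingType) (V : lmodType R) (N : submod V) :
  submod_closed N := submod_funP N.

HB.instance Definition _ (R : comPzRingType) (V : lmodType R) (N : submod V) :=
  GRing.isSubmodClosed.Build R V (submod_pred N) (submodP N).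

Section Generated.
Variables (R : comPzRingType) (V : lmodType R).
Implicit Type S : set V.

Definition gen_pred S : V -> bool :=
  fun x => `[< forall N : submod V, (forall y, S y -> y \in N) -> x \in N >].

Fact gen_closed S : submod_closed (gen_pred S).
Proof.
split=> [|a u v /asboolP Su /asboolP Sv]; apply/asboolP => N SN.
  exact: rpred0.
by rewrite rpredD ?rpredZ ?Su ?Sv.
Qed.

(* The smallest submodule containing S. *)
Definition gen S : submod V := Submod (gen_closed S).
End Generated.

Section SubmoduleType.
Variables (R : comPzRingType) (V : lmodType R) (N : submod V).

Record submodule := Submodule { submodule_val :> V; _ : submodule_val \in N }.

HB.instance Definition _ := [isSub for submodule_val].
HB.instance Definition _ := [Choice of submodule by <:].
HB.instance Definition _ := GRing.SubChoice_isSubLmodule.Build R V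
  (fun x => x \in N) submodule (submodP N).
End SubmoduleType.

(* The underlying abelian group is the library's quotient by an additive
   subgroup; it receives the induced scaling. *)
Definition quotmod (R : comPzRingType) (V : lmodType R) (N : submod V) :=
  Quotient.quot (GRing.ZmodClosed.clone V (submod_pred N) _).

Section QuotientModule.
Variables (R : comPzRingType) (V : lmodType R) (N : submod V).
Local Notation Q := (quotmod N).

HB.instance Definition _ := GRing.Zmodule.on Q.

Definition quotmod_pi (x : V) : Q := \pi_(quotmod N) x.

Lemma quotmod_piP x y : quotmod_pi x = quotmod_pi y <-> x - y \in N.
Proof. by rewrite Quotient.idealrBE; split=> /eqP. Qed.

Lemma quotmod_reprK (x : Q) : quotmod_pi (repr x) = x.
Proof. exact: reprK. Qed.

Lemma quotmod_piD x y : quotmod_pi (x + y) = quotmod_pi x + quotmod_pi y.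
Proof. exact: Quotient.pi_add. Qed.

Definition quotmod_scale (a : R) (x : Q) : Q := quotmod_pi (a *: repr x).

Lemma quotmod_piZ a x : quotmod_scale a (quotmod_pi x) = quotmod_pi (a *: x).
Proof.
apply/quotmod_piP; rewrite -scalerBr rpredZ //.
by apply/quotmod_piP; rewrite quotmod_reprK.
Qed.

Fact quotmod_scaleA a b x :
  quotmod_scale a (quotmod_scale b x) = quotmod_scale (a * b) x.
Proof. by rewrite -[x]quotmod_reprK !quotmod_piZ scalerA. Qed.

Fact quotmod_scale1 : left_id 1 quotmod_scale.
Proof. by move=> x; rewrite -[x]quotmod_reprK quotmod_piZ scale1r. Qed.

Fact quotmod_scaleDr : right_distributive quotmod_scale +%R.
Proof.
move=> a x y; rewrite -[x]quotmod_reprK -[y]quotmod_reprK -quotmod_piD.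
by rewrite !quotmod_piZ scalerDr quotmod_piD.
Qed.

Fact quotmod_scaleDl x : {morph quotmod_scale^~ x : a b / a + b}.
Proof.
move=> a b; rewrite -[x]quotmod_reprK.
by rewrite !quotmod_piZ scalerDl quotmod_piD.
Qed.

HB.instance Definition _ := GRing.Zmodule_isLmodule.Build R Q
  quotmod_scaleA quotmod_scale1 quotmod_scaleDr quotmod_scaleDl.
End QuotientModule.

(** * Ideals, quotient rings, the spectrum *)

(* The unit ideal is allowed. *)
Notation ideal R := (submod (R : comPzRingType)^o).

Lemma idealMl (R : comPzRingType) (I : ideal R) (x y : R) :
  y \in I -> x * y \in I.
Proof. by move=> yI; exact: (@rpredZ _ _ I x (y : R^o)). Qed.

Definition quotring (R : comPzRingType) (I : ideal R) := quotmod I.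

Section QuotientRing.
Variables (R : comPzRingType) (I : ideal R).
Local Notation Q := (quotring I).

HB.instance Definition _ := GRing.Zmodule.on Q.

Definition quotring_pi (x : R) : Q := quotmod_pi I x.

Definition quotring_mul (x y : Q) : Q := quotring_pi (repr x * repr y).

Lemma quotring_piP x y : quotring_pi x = quotring_pi y <-> x - y \in I.
Proof. exact: quotmod_piP. Qed.

Lemma quotring_reprK (x : Q) : quotring_pi (repr x) = x.
Proof. exact: reprK. Qed.

Lemma quotring_piD x y : quotring_pi (x + y) = quotring_pi x + quotring_pi y.
Proof. exact: Quotient.pi_add. Qed.

Lemma quotring_piM x y :
  quotring_mul (quotring_pi x) (quotring_pi y) = quotring_pi (x * y).
Proof.
have rI z : repr (quotring_pi z) - z \in I.
  by apply/quotring_piP; rewrite quotring_reprK.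
apply/quotring_piP; set x' := repr _; set y' := repr _.
rewrite (_ : x' * y' - x * y = x' * (y' - y) + y * (x' - x)); last by ring.
by apply: (rpredD (V := R^o)); exact/idealMl/rI.
Qed.

Fact quotring_mulA : associative quotring_mul.
Proof.
move=> x y z; rewrite -[x]quotring_reprK -[y]quotring_reprK -[z]quotring_reprK.
by rewrite !quotring_piM mulrA.
Qed.

Fact quotring_mulC : commutative quotring_mul.
Proof. by move=> x y; rewrite /quotring_mul mulrC. Qed.

Fact quotring_mul1 : left_id (quotring_pi 1) quotring_mul.
Proof. by move=> x; rewrite -[x]quotring_reprK quotring_piM mul1r. Qed.

Fact quotring_mulDl : left_distributive quotring_mul +%R.
Proof.
move=> x y z; rewrite -[x]quotring_reprK -[y]quotring_reprK -[z]quotring_reprK.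
by rewrite -quotring_piD !quotring_piM mulrDl quotring_piD.
Qed.

HB.instance Definition _ := GRing.Zmodule_isComPzRing.Build Q
  quotring_mulA quotring_mulC quotring_mul1 quotring_mulDl.
End QuotientRing.

Record spec (R : comPzRingType) := Spec {
  prime_ideal :> ideal R;
  spec1 : 1 \notin prime_ideal;
  specM : forall x y : R, x * y \in prime_ideal ->
    x \in prime_ideal \/ y \in prime_ideal }.

Section IdealOperations.
Variable R : comPzRingType.

Definition ideal_le (I J : ideal R) := forall x : R, x \in I -> x \in J.

Definition zero_locus (b : ideal R) : set (spec R) := [set p | ideal_le b p].

Definition ideal_add (I J : ideal R) : ideal R :=
  gen ([set x | x \in I \/ x \in J] : set R^o).

(* The submodule I N, for N a submodule of W. *)
Definition ideal_smul (I : ideal R) (W : lmodType R) (N : submod W)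
    : submod W :=
  gen [set y | exists r : R, exists x : W, [/\ r \in I, x \in N & y = r *: x]].

Definition full (W : lmodType R) : submod W := gen [set: W].

Fixpoint ideal_pow (I : ideal R) (t : nat) : ideal R :=
  if t is t'.+1 then ideal_smul I (ideal_pow I t') else full R^o.

(* The ideal of S generated by the image of I. *)
Definition ideal_map (S : comPzRingType) (f : R -> S) (I : ideal R) : ideal S :=
  gen ([set f x | x in [set x | x \in I]] : set S^o).

Definition submod_fg (W : lmodType R) (N : submod W) : Prop :=
  exists s : seq W, forall x, (x \in N) = (x \in gen [set y | y \in s]).

Definition fg_module (W : lmodType R) : Prop := submod_fg (full W).

Definition noetherian : Prop := forall I : ideal R, submod_fg I.

End IdealOperations.

(** * Localization at a prime *)

Section Localization.
Variables (R : comPzRingType) (p : spec R).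

Record denom := Denom { den :> R; _ : den \notin p }.
HB.instance Definition _ := [isSub for den].
HB.instance Definition _ := [Choice of denom by <:].

Fact denomM (s t : denom) : den s * den t \notin p.
Proof.
by case: s t => [s ps] [t pt]; apply/negP => /specM []; apply/negP.
Qed.

Definition denom_mul (s t : denom) : denom := Denom (denomM s t).
Definition denom1 : denom := Denom (spec1 p).

Section Module.
Variable M : lmodType R.

(* m/s = m'/s' iff u (s' m - s m') = 0 for some u outside p. *)
Definition loc_equiv (x y : M * denom) : bool :=
  `[< exists u : denom,
        (den u * den y.2) *: x.1 = (den u * den x.2) *: y.1 >].

Fact loc_equivP : equiv_class_of loc_equiv.
Proof.
split=> [x|x y|y x z].
- by apply/asboolP; exists denom1.
- by apply/asboolP/asboolP => -[u e]; exists u.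
- move=> /asboolP[u e1] /asboolP[v e2]; apply/asboolP.
  exists (denom_mul (denom_mul u v) y.2) => /=.
  transitivity ((den v * den z.2) *: ((den u * den y.2) *: x.1)).
    by rewrite scalerA; congr (_ *: _); ring.
  rewrite e1 scalerA.
  transitivity ((den u * den x.2) *: ((den v * den z.2) *: y.1)).
    by rewrite scalerA; congr (_ *: _); ring.
  by rewrite e2 scalerA; congr (_ *: _); ring.
Qed.

Canonical loc_equiv_rel := EquivRelPack loc_equivP.
Canonical loc_encModRel := defaultEncModRel loc_equiv.

Definition locmod := {eq_quot loc_equiv}.
HB.instance Definition _ := Choice.on locmod.

Definition mfrac (m : M) (s : denom) : locmod :=
  \pi_{eq_quot loc_equiv} (m, s).

Lemma mfracP m s m' s' : mfrac m s = mfrac m' s' <->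
  exists u : denom, (den u * den s') *: m = (den u * den s) *: m'.
Proof.
split=> [/eqP|h]; first by rewrite /mfrac piE => /asboolP.
by apply/eqP; rewrite /mfrac piE; apply/asboolP.
Qed.

Lemma mfracW (x : locmod) : exists m s, x = mfrac m s.
Proof. by exists (repr x).1, (repr x).2; rewrite /mfrac -surjective_pairing reprK. Qed.

Lemma mfrac_repr m s : exists u : denom,
  (den u * den s) *: (repr (mfrac m s)).1
  = (den u * den (repr (mfrac m s)).2) *: m.
Proof. by apply/mfracP; rewrite /mfrac -surjective_pairing reprK. Qed.

Definition loc_add (x y : locmod) : locmod :=
  mfrac (den (repr y).2 *: (repr x).1 + den (repr x).2 *: (repr y).1)
       (denom_mul (repr x).2 (repr y).2).

Definition loc_opp (x : locmod) : locmod := mfrac (- (repr x).1) (repr x).2.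

Lemma mfrac_add m s m' s' : loc_add (mfrac m s) (mfrac m' s') =
  mfrac (den s' *: m + den s *: m') (denom_mul s s').
Proof.
rewrite /loc_add; have [u eu] := mfrac_repr m s; have [v ev] := mfrac_repr m' s'.
move: (repr _) eu => [n t] /= eu; move: (repr _) ev => [n' t'] /= ev.
apply/mfracP; exists (denom_mul u v) => /=; rewrite !scalerDr !scalerA; congr (_ + _).
- transitivity ((den v * den t' * den s') *: ((den u * den s) *: n)).
    by rewrite scalerA; congr (_ *: _); ring.
  by rewrite eu scalerA; congr (_ *: _); ring.
- transitivity ((den u * den t * den s) *: ((den v * den s') *: n')).
    by rewrite scalerA; congr (_ *: _); ring.
  by rewrite ev scalerA; congr (_ *: _); ring.
Qed.

Lemma mfrac_opp m s : loc_opp (mfrac m s) = mfrac (- m) s.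
Proof.
rewrite /loc_opp; have [u eu] := mfrac_repr m s.
by apply/mfracP; exists u; rewrite !scalerN eu.
Qed.

Fact loc_addA : associative loc_add.
Proof.
move=> x y z; have [m [s ->]] := mfracW x; have [m' [s' ->]] := mfracW y.
have [m'' [s'' ->]] := mfracW z; rewrite !mfrac_add.
apply/mfracP; exists denom1 => /=; rewrite !scalerDr !scalerA !addrA.
by congr (_ *: _ + _ *: _ + _ *: _); ring.
Qed.

Fact loc_addC : commutative loc_add.
Proof.
move=> x y; have [m [s ->]] := mfracW x; have [m' [s' ->]] := mfracW y.
rewrite !mfrac_add; apply/mfracP; exists denom1 => /=.
by rewrite addrC [den s' * _]mulrC.
Qed.

Fact loc_add0 : left_id (mfrac 0 denom1) loc_add.
Proof.
move=> x; have [m [s ->]] := mfracW x; rewrite mfrac_add.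
apply/mfracP; exists denom1 => /=.
by rewrite scaler0 add0r scale1r !mul1r.
Qed.

Fact loc_addN : left_inverse (mfrac 0 denom1) loc_opp loc_add.
Proof.
move=> x; have [m [s ->]] := mfracW x; rewrite mfrac_opp mfrac_add.
apply/mfracP; exists denom1 => /=.
by rewrite scalerN addNr !scaler0.
Qed.

HB.instance Definition _ :=
  GRing.isZmodule.Build locmod loc_addA loc_addC loc_add0 loc_addN.

Lemma mfracD m s m' s' : mfrac m s + mfrac m' s' =
  mfrac (den s' *: m + den s *: m') (denom_mul s s').
Proof. exact: mfrac_add. Qed.

End Module.

Definition locring := locmod R^o.
HB.instance Definition _ := GRing.Zmodule.on locring.

Section Scale.
Variable M : lmodType R.

Definition loc_scale (a : locring) (x : locmod M) : locmod M :=
  mfrac ((repr a).1 *: (repr x).1) (denom_mul (repr a).2 (repr x).2).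

Lemma mfrac_scale (r : R) s m t : loc_scale (mfrac (r : R^o) s) (mfrac m t) =
  mfrac (r *: m) (denom_mul s t).
Proof.
rewrite /loc_scale; have [u eu] := mfrac_repr (r : R^o) s.
have [v ev] := mfrac_repr m t.
move: (repr _) eu => [r' s'] /= eu; move: (repr _) ev => [m' t'] /= ev.
have {}eu : den u * den s * r' = den u * den s' * r by [].
apply/mfracP; exists (denom_mul u v) => /=; rewrite !scalerA.
transitivity ((den u * den s * r') *: ((den v * den t) *: m')).
  by rewrite scalerA; congr (_ *: _); ring.
by rewrite eu ev scalerA; congr (_ *: _); ring.
Qed.
End Scale.

Definition loc_mul : locring -> locring -> locring := @loc_scale R^o.

Definition loc_frac (r : R) (s : denom) : locring := mfrac (r : R^o) s.
Definition loc_inj (r : R) : locring := loc_frac r denom1.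

Lemma loc_fracW (x : locring) : exists r s, x = loc_frac r s.
Proof. by have [r [s ->]] := mfracW x; exists r, s. Qed.

Lemma loc_mul_frac r s r' s' : loc_mul (loc_frac r s) (loc_frac r' s') =
  loc_frac (r * r') (denom_mul s s').
Proof. exact: mfrac_scale. Qed.

Lemma loc_fracP r s r' s' : loc_frac r s = loc_frac r' s' <->
  exists u : denom, den u * den s' * r = den u * den s * r'.
Proof. exact: mfracP. Qed.

Lemma loc_fracD r s r' s' : loc_frac r s + loc_frac r' s' =
  loc_frac (den s' * r + den s * r') (denom_mul s s').
Proof. exact: mfrac_add. Qed.

Fact loc_mulA : associative loc_mul.
Proof.
move=> x y z; have [m [s ->]] := loc_fracW x; have [m' [s' ->]] := loc_fracW y.
have [m'' [s'' ->]] := loc_fracW z; rewrite !loc_mul_frac.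
by apply/loc_fracP; exists denom1 => /=; ring.
Qed.

Fact loc_mulC : commutative loc_mul.
Proof.
move=> x y; have [m [s ->]] := loc_fracW x; have [m' [s' ->]] := loc_fracW y.
by rewrite !loc_mul_frac; apply/loc_fracP; exists denom1 => /=; ring.
Qed.

Fact loc_mul1 : left_id (loc_inj 1) loc_mul.
Proof.
move=> x; have [m [s ->]] := loc_fracW x.
by rewrite loc_mul_frac; apply/loc_fracP; exists denom1 => /=; ring.
Qed.

Fact loc_mulDl : left_distributive loc_mul +%R.
Proof.
move=> x y z; have [m [s ->]] := loc_fracW x; have [m' [s' ->]] := loc_fracW y.
have [m'' [s'' ->]] := loc_fracW z; rewrite loc_fracD !loc_mul_frac loc_fracD.
by apply/loc_fracP; exists denom1 => /=; ring.
Qed.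

HB.instance Definition _ := GRing.Zmodule_isComPzRing.Build locring
  loc_mulA loc_mulC loc_mul1 loc_mulDl.

Section ScaleModule.
Variable M : lmodType R.

Lemma loc_scale_frac r s (m : M) t :
  loc_scale (loc_frac r s) (mfrac m t) = mfrac (r *: m) (denom_mul s t).
Proof. exact: mfrac_scale. Qed.

Fact loc_scaleA a b (x : locmod M) :
  loc_scale a (loc_scale b x) = loc_scale (a * b) x.
Proof.
have [m [s ->]] := loc_fracW a; have [m' [s' ->]] := loc_fracW b.
have [m'' [s'' ->]] := mfracW x.
rewrite [_ * _]loc_mul_frac !loc_scale_frac.
by apply/mfracP; exists denom1 => /=; rewrite !scalerA; congr (_ *: _); ring.
Qed.

Fact loc_scale1 : left_id 1 (@loc_scale M).
Proof.
move=> x; have [m [s ->]] := mfracW x.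
by rewrite loc_scale_frac; apply/mfracP; exists denom1 => /=; rewrite scale1r !mul1r.
Qed.

Fact loc_scaleDr : right_distributive (@loc_scale M) +%R.
Proof.
move=> a x y; have [m [s ->]] := loc_fracW a; have [m' [s' ->]] := mfracW x.
have [m'' [s'' ->]] := mfracW y; rewrite mfracD !loc_scale_frac mfracD.
apply/mfracP; exists denom1 => /=; rewrite !scalerDr !scalerA.
by congr (_ *: _ + _ *: _); ring.
Qed.

Fact loc_scaleDl (x : locmod M) : {morph (@loc_scale M)^~ x : a b / a + b}.
Proof.
move=> a b; have [m [s ->]] := loc_fracW a; have [m' [s' ->]] := loc_fracW b.
have [m'' [s'' ->]] := mfracW x; rewrite loc_fracD !loc_scale_frac mfracD.
apply/mfracP; exists denom1 => /=; rewrite scalerDr !scalerA -scalerDl.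
by congr (_ *: _); ring.
Qed.

HB.instance Definition _ := GRing.Zmodule_isLmodule.Build locring (locmod M)
  loc_scaleA loc_scale1 loc_scaleDr loc_scaleDl.
End ScaleModule.

(* The maximal ideal pR_p of the local ring R_p. *)
Definition loc_max : ideal locring := ideal_map loc_inj p.

End Localization.

(** * Dimension, height, support, depth *)

Section Dimension.
Variable R : comPzRingType.

(* Supremum of the lengths of chains p_0 < ... < p_l of primes lying in Z;
   for Z closed under specialization, e.g. a support, this is also the
   supremum of dim R/p for p in Z. *)
Definition dim_set (Z : set (spec R)) : \bar int :=
  esup [set enat l | l in [set l : nat | exists c : nat -> spec R,
    (forall i, (i <= l)%N -> Z (c i)) /\
    (forall i, (i < l)%N ->
       ideal_le (c i) (c i.+1) /\ ~ ideal_le (c i.+1) (c i))]].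

Definition krull_dim : \bar int := dim_set [set: spec R].

Definition prime_height (p : spec R) : \bar int :=
  dim_set [set q : spec R | ideal_le q p].

Definition height (I : ideal R) : \bar int :=
  einf [set prime_height p | p in zero_locus I].

Definition Supp (M : lmodType R) : set (spec R) :=
  [set p | exists x : locmod p M, x <> 0].

End Dimension.

Section Depth.
Variables (R : comPzRingType) (m : ideal R) (M : lmodType R).

Definition ideal_gen (s : seq R) : ideal R := gen ([set x | x \in s] : set R^o).

(* s = x_1, ..., x_r is an M-regular sequence: x_{i+1} is a nonzerodivisor on
   M/(x_1, ..., x_i)M for i < r, and M/(x_1, ..., x_r)M is nonzero. *)
Definition regular_seq (s : seq R) : Prop :=
  (forall i, (i < size s)%N ->
     forall y : quotmod (ideal_smul (ideal_gen (take i s)) (full M)),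
       s`_i *: y = 0 -> y = 0) /\
  (exists y : quotmod (ideal_smul (ideal_gen s) (full M)), y <> 0).

(* Supremum of the lengths of M-regular sequences in m. *)
Definition depth : \bar int :=
  if `[< forall x : M, x = 0 >] then +oo%E
  else esup [set enat (size s) | s in
         [set s : seq R | {subset s <= m} /\ regular_seq s]].

End Depth.

(** * Local cohomology *)

Section LocalCohomology.
Variable R : comPzRingType.

Definition torsion_pred (a : ideal R) (W : lmodType R) : W -> bool :=
  fun x => `[< exists t : nat, forall r : R, r \in ideal_pow a t -> r *: x = 0 >].

Lemma ideal_powS (a : ideal R) t : ideal_le (ideal_pow a t.+1) (ideal_pow a t).
Proof.
move=> x /asboolP; apply=> y [r [z [_ zt ->]]]; exact: rpredZ.
Qed.

Lemma ideal_pow_le (a : ideal R) s t : (s <= t)%N ->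
  ideal_le (ideal_pow a t) (ideal_pow a s).
Proof.
elim: t => [|t IH]; first by rewrite leqn0 => /eqP->.
rewrite leq_eqVlt => /predU1P[-> //|lst] x /ideal_powS; exact: IH.
Qed.

Fact torsion_closed a W : submod_closed (@torsion_pred a W).
Proof.
split=> [|c u v /asboolP[s us] /asboolP[t vt]]; apply/asboolP.
  by exists 0%N => r _; rewrite scaler0.
exists (maxn s t) => r ra; rewrite scalerDr scalerA mulrC -scalerA.
rewrite us ?vt ?scaler0 ?addr0 //.
  exact: ideal_pow_le (leq_maxr s t) _ ra.
exact: ideal_pow_le (leq_maxl s t) _ ra.
Qed.

Definition torsion a W : submod W := Submod (torsion_closed a W).

(* The a-torsion functor Gamma_a on modules and on linear maps. *)
Definition Gamma (a : ideal R) (W : lmodType R) : lmodType R := submodule (torsion a W).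

Section GammaMap.
Variables (a : ideal R) (W W' : lmodType R) (f : {linear W -> W'}).

Fact Gamma_map_subproof (x : Gamma a W) : f (val x) \in torsion a W'.
Proof.
have /asboolP[t xt] := valP x; apply/asboolP; exists t => r ra.
by rewrite -linearZ xt // linear0.
Qed.

Definition Gamma_map (x : Gamma a W) : Gamma a W' :=
  Sub (f (val x)) (Gamma_map_subproof x).

Fact Gamma_map_linear : linear Gamma_map.
Proof. by move=> c x y; apply: val_inj; rewrite /= linearP. Qed.

HB.instance Definition _ :=
  GRing.isLinear.Build R (Gamma a W) (Gamma a W') _ Gamma_map Gamma_map_linear.
End GammaMap.

Definition injective_module (I : lmodType R) : Prop :=
  forall (A B : lmodType R) (f : {linear A -> B}) (g : {linear A -> I}),
    injective f -> exists h : {linear B -> I}, forall x, h (f x) = g x.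

Record injective_resolution (M : lmodType R) := InjectiveResolution {
  ir_obj : nat -> lmodType R;
  ir_d : forall i, {linear ir_obj i -> ir_obj i.+1};
  ir_aug : {linear M -> ir_obj 0};
  ir_injective : forall i, injective_module (ir_obj i);
  ir_aug_inj : injective ir_aug;
  ir_exact0 : forall x, ir_d 0 x = 0 <-> exists y, ir_aug y = x;
  ir_exact : forall i x, ir_d i.+1 x = 0 <-> exists y, ir_d i y = x }.

Section Cohomology.
Variables (C : nat -> lmodType R) (d : forall i, {linear C i -> C i.+1}).

Definition cocycle_pred i : C i -> bool := fun x => `[< d i x = 0 >].

Fact cocycle_closed i : submod_closed (@cocycle_pred i).
Proof.
split=> [|c u v /asboolP du /asboolP dv]; apply/asboolP; first exact: linear0.
by rewrite linearP du dv scaler0 addr0.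
Qed.

Definition cocycles i : lmodType R := submodule (Submod (@cocycle_closed i)).

(* The cocycles that are coboundaries, with C^{-1} = 0. *)
Definition coboundary_pred i : cocycles i -> bool :=
  match i return cocycles i -> bool with
  | 0 => fun x => `[< val x = 0 >]
  | j.+1 => fun x => `[< exists y : C j, d j y = val x >]
  end.

Fact coboundary_closed i : submod_closed (@coboundary_pred i).
Proof.
case: i => [|j]; split=> [|c u v /asboolP + /asboolP]; first exact/asboolP.
- by move=> u0 v0; apply/asboolP; rewrite /= u0 v0 scaler0 addr0.
- by apply/asboolP; exists 0; rewrite linear0.
- by move=> [y yu] [z zv]; apply/asboolP; exists (c *: y + z); rewrite linearP yu zv.
Qed.

Definition cohomology i : lmodType R :=
  quotmod (Submod (@coboundary_closed i)).
End Cohomology.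

(* H^i_a(M), the i-th right derived functor of Gamma_a, computed from an
   injective resolution E of M; up to isomorphism it does not depend on E. *)
Definition local_cohomology (a : ideal R) (M : lmodType R)
    (E : injective_resolution M) (i : nat) : lmodType R :=
  @cohomology (fun j => Gamma a (ir_obj E j))
    (fun j => @Gamma_map a _ _ (ir_d E j)) i.

End LocalCohomology.

(** * The invariants *)

Section Invariants.
Variable R : comPzRingType.
Implicit Types (a b : ideal R) (M : lmodType R).

Definition depth_at M (p : spec R) : \bar int := depth (loc_max p) (locmod p M).

Definition lambda a b M : \bar int :=
  einf [set (depth_at M p
             + height (ideal_map (@quotring_pi R p) (ideal_add a p)))%E
       | p in ~` zero_locus b].

Definition f_n a b M (E : injective_resolution M) (n : nat) : \bar int :=
  einf [set enat i | i in [set i : nat | forall t : nat,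
    (enat n <= dim_set (Supp (submodule
       (ideal_smul (ideal_pow b t) (full (local_cohomology a E i))))))%E]].

End Invariants.

Definition lambda_n (R : comPzRingType) (a b : ideal R) (M : lmodType R) (n : nat)
    : \bar int :=
  einf [set @lambda (locring p) (ideal_map (@loc_inj R p) a)
                    (ideal_map (@loc_inj R p) b) (locmod p M)
       | p in [set p : spec R | (enat n <= krull_dim (quotring p))%E]].

(* Main.v *)
From HB Require Import structures.
Require Import Defs.
From mathcomp Require Import all_boot all_order all_algebra.
From mathcomp Require Import boolp classical_sets constructive_ereal.
From mathcomp Require Import ring.

(** Write H^i for the i-th local cohomology of M with support in a, and lambda
for the invariant lambda_a^b(M)_n. The bound on dim R makes the inequality
collapse to two facts.

- Degree 0 never belongs to the set whose infimum is f_a^b(M)_n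
  ([Supp_ideal_pow_local_cohomology0]): H^0 is the a-torsion of M, which is
  finitely generated, so one power of a, hence of b, annihilates it and leaves
  an empty support.

- If some degree i does belong to that set, then lambda <= dim R <= 2
  ([lambda_n_le_of_Supp]). In a noetherian ring finitely many primes L over
  I = Ann M have product inside I ([prime_prod_sub]). Put t = |L|. The support
  of b^t H^i contains a prime p with dim R/p >= n; it contains a because H^i is
  a-torsion. If every q in L contained b or escaped p, then some u outside p
  would satisfy u b^t <= I ([ideal_pow_prime_prod]); as I annihilates H^i
  ([annihilator_local_cohomology]), u would kill b^t H^i, against the choice
  of p. So some q in L lies in p and does not contain b, and it may be taken
  minimal in L. Applying the same lemma with q in the roles of both b and p
  shows that a power of q kills M up to a unit at q, so that M_q is nonzero and
  has depth 0. The height of (a + q)/q in R_p/q is at most dim R because a lies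
  in p. Thus q contributes at most dim R to lambda.

Therefore a degree i of the set satisfies i >= 1 and lambda - 1 <= 1 <= i. *)

Set Implicit Arguments.
Unset Strict Implicit.
Unset Printing Implicit Defensive.

Import Order.TTheory GRing.Theory Num.Theory.
Local Open Scope classical_set_scope.
Local Open Scope ring_scope.

(* Otherwise simplification turns x \in gen S into the defining quantification
   over submodules. *)
Arguments submod_pred : simpl never.

(** * Suprema and infima in the extended integers *)

Section ExtendedIntegers.
Implicit Types (A : set (\bar int)) (x y : \bar int).

(** Bounded nonempty sets of integers attain their supremum; the other cases
are infinite. Completeness is what makes [einf] and [esup] genuine bounds,
their values being otherwise a default. *)
Lemma supremums_neq0 A : supremums A !=set0.
Proof.
have [noub|/existsNP[k /contrapT Ak]] :=
  pselect (forall k : int, ~ ubound A k%:E).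
  have [Aoo|/existsNP[x /not_implyP[Ax xoo]]] := pselect (ubound A -oo%E).
    by exists -oo%E; split => // y _; exact: leNye.
  exists +oo%E; split=> [y _|y Ay]; first exact: leey.
  case: y Ay => [k /noub //|//|Ay].
  by case: xoo; exact: Ay.
have [Aoo|/existsNP[x /not_implyP[Ax xoo]]] := pselect (ubound A -oo%E).
  by exists -oo%E; split => // y _; exact: leNye.
have [r rx] : exists r : int, x = r%:E.
  case: x Ax xoo => [r|/Ak //|] Ax xoo; first by exists r.
  by case: xoo.
have exP : exists m : nat, `[< ubound A (r + m%:Z)%:E >].
  exists `|k - r|%N; apply/asboolP; rewrite gez0_abs ?subrKC //.
  by rewrite subr_ge0 -lee_fin -rx; exact: Ak.
case: (ex_minnP exP) => m /asboolP Am mmin.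
exists (r + m%:Z)%:E; split=> // -[l Al|_|Al].
- have rl : r <= l by rewrite -lee_fin -rx; exact: Al.
  rewrite lee_fin -lerBrDl -[l - r]gez0_abs ?subr_ge0 // lez_nat.
  by apply: mmin; apply/asboolP; rewrite gez0_abs ?subrKC ?subr_ge0.
- exact: leey.
- by case: xoo; exact: Al.
Qed.

Lemma infimums_neq0 A : infimums A !=set0.
Proof.
have [s [ls su]] := supremums_neq0 (lbound A).
by exists s; split=> // x Ax; apply: su => y; apply.
Qed.

Lemma einf_le A x : A x -> (einf A <= x)%E.
Proof. exact/le_infimum_Nmem/infimums_neq0. Qed.

Lemma le_einf A y : (forall x, A x -> (y <= x)%E) -> (y <= einf A)%E.
Proof.
move=> yA; rewrite /einf /infimum; case: ifPn => _; first exact: leey.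
have [z Az] := infimums_neq0 A.
by case: xgetP => [w _ [_]|/(_ z)//]; apply.
Qed.

Lemma le_esup A x : A x -> (x <= esup A)%E.
Proof. exact/ge_supremum_Nmem/supremums_neq0. Qed.

Lemma esup_le A y : (forall x, A x -> (x <= y)%E) -> (esup A <= y)%E.
Proof.
move=> yA; rewrite /esup /supremum; case: ifPn => _; first exact: leNye.
have [z Az] := supremums_neq0 A.
by case: xgetP => [w _ [_]|/(_ z)//]; apply.
Qed.

Lemma le_enat m n : (enat m <= enat n)%E = (m <= n)%N.
Proof. by rewrite lee_fin lez_nat. Qed.

(** A supremum of natural numbers at least [n] is approached by an actual member
at least [n] even when it is infinite: otherwise [n - 1] would be a bound. *)
Lemma esup_enat_witness (P : set nat) n :
  (enat n <= esup [set enat l | l in P])%E -> exists2 l, P l & (n <= l)%N.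
Proof.
move=> nP; apply: contrapT => noP; move: nP; apply/negP; rewrite -ltNge.
apply: (@le_lt_trans _ _ ((n%:Z - 1)%:E)); last by rewrite lte_fin gtrBl.
apply: esup_le => _ [l Pl <-]; rewrite lee_fin lerBrDr.
rewrite lezD1 ltz_nat ltnNge; apply/negP => nl.
by apply: noP; exists l.
Qed.

End ExtendedIntegers.

(** * Generated submodules and submodules cut out by a property *)

Section Submodules.
Variables (R : comPzRingType) (V : lmodType R).
Implicit Type N : submod V.

Lemma mem_gen (S : set V) y : S y -> y \in gen S.
Proof. by move=> Sy; apply/asboolP => N; apply. Qed.

Lemma gen_sub (S : set V) N :
  (forall y, S y -> y \in N) -> forall x, x \in gen S -> x \in N.
Proof. by move=> SN x /asboolP; exact. Qed.

Lemma mem_full x : x \in full V.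
Proof. exact: mem_gen. Qed.

Section Comprehension.
Variable P : V -> Prop.
Hypothesis PZD : P 0 /\ forall (c : R) x y, P x -> P y -> P (c *: x + y).

Fact comprehension_closed : submod_closed (fun x => `[< P x >]).
Proof.
by split=> [|c x y /asboolP Px /asboolP Py]; apply/asboolP;
  [exact: PZD.1|exact: PZD.2].
Qed.

Definition comprehension : submod V := Submod comprehension_closed.

Lemma mem_comprehension x : x \in comprehension <-> P x.
Proof. by split=> /asboolP. Qed.
End Comprehension.

Lemma scale_closed (N : submod V) (r : R) :
  r *: (0 : V) \in N /\ forall (c : R) x y,
    r *: x \in N -> r *: y \in N -> r *: (c *: x + y) \in N.
Proof.
split=> [|c x y xN yN]; first by rewrite scaler0 rpred0.
by rewrite scalerDr scalerA mulrC -scalerA rpredD // rpredZ.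
Qed.

Definition colon N (r : R) : submod V :=
  comprehension (scale_closed N r).

Lemma mem_colon N r x : x \in colon N r <-> r *: x \in N.
Proof. exact: mem_comprehension. Qed.

Lemma mem_zero x : x \in gen (set0 : set V) -> x = 0.
Proof.
have PZD : 0 = 0 :> V /\ forall (c : R) (x y : V),
    x = 0 -> y = 0 -> c *: x + y = 0.
  by split=> // c {}x y -> ->; rewrite scaler0 addr0.
move=> x0; apply/(mem_comprehension (P := fun x => x = 0) PZD).
exact: gen_sub x0.
Qed.

Lemma mem_ideal_smul (I : ideal R) N r x :
  r \in I -> x \in N -> r *: x \in ideal_smul I N.
Proof. by move=> rI xN; apply: mem_gen; exists r, x. Qed.

Lemma ideal_smul_sub (I : ideal R) N N' :
  (forall r x, r \in I -> x \in N -> r *: x \in N') ->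
  forall x, x \in ideal_smul I N -> x \in N'.
Proof. by move=> h; apply: gen_sub => _ [r [x [rI xN ->]]]; exact: h. Qed.

(** The elements killed by [u] form a submodule, so it is enough to look at the
generators of I N. *)
Lemma scale_eq0_ideal_smul (I : ideal R) N (u : R) :
  (forall r x, r \in I -> x \in N -> (u * r) *: x = 0) ->
  forall x, x \in ideal_smul I N -> u *: x = 0.
Proof.
move=> h x xIN; apply/mem_zero/mem_colon; move: x xIN.
apply: ideal_smul_sub => r x rI xN; apply/mem_colon.
by rewrite scalerA h ?rpred0.
Qed.
End Submodules.

(** * Noetherian rings and modules *)

(** The common form of the finiteness arguments below: members of an increasing
union, exponents of torsion, denominators killing generators. *)
Lemma directed_seq (T : eqType) (I : Type) (i0 : I) (Q : I -> T -> Prop) :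
  (forall i j, exists k, forall y, Q i y \/ Q j y -> Q k y) ->
  forall s : seq T, (forall y, y \in s -> exists i, Q i y) ->
  exists i, forall y, y \in s -> Q i y.
Proof.
move=> dirQ; elim=> [|x s IH] sQ; first by exists i0.
have [i iQ] := sQ x (mem_head x s).
have [|j jQ] := IH; first by move=> y ys; apply: sQ; rewrite inE ys orbT.
have [k kQ] := dirQ i j; exists k => y /predU1P[-> |/jQ jy]; apply: kQ.
  by left.
by right.
Qed.

Definition ideal_lt (R : comPzRingType) (I J : ideal R) :=
  ideal_le I J /\ ~ ideal_le J I.

Section Noetherian.
Variable R : comPzRingType.
Hypothesis noethR : noetherian R.

(** A failure of the induction yields a strictly ascending sequence of ideals;
its union is finitely generated, hence already equal to one of its terms. *)
Lemma noetherian_ind (P : ideal R -> Prop) :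
  (forall I, (forall J, ideal_lt I J -> P J) -> P I) -> forall I, P I.
Proof.
move=> stepP I0; apply: contrapT => notP0.
have next (I : {I | ~ P I}) :
    exists J : {J | ~ P J}, ideal_lt (sval I) (sval J).
  case: I => I /= notPI; apply: contrapT => noJ; apply/notPI/stepP => J IJ.
  by apply: contrapT => notPJ; apply: noJ; exists (exist _ J notPJ).
have [f fP] := choice next.
pose c n := sval (iter n f (exist _ I0 notP0)).
have cS n : ideal_lt (c n) (c n.+1) by exact: fP.
have cW m n : (m <= n)%N -> ideal_le (c m) (c n).
  move=> mn x; elim: n mn => [|n IH]; first by rewrite leqn0 => /eqP->.
  by rewrite leq_eqVlt => /predU1P[->//|/IH xn] /xn; apply: (cS n).1.
have unionP : (exists n, 0 \in c n) /\ forall (r : R) (x y : R^o),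
    (exists n, x \in c n) -> (exists n, y \in c n) ->
    exists n, r *: x + y \in c n.
  split=> [|r x y [m xm] [n yn]]; first by exists 0; exact: rpred0.
  exists (maxn m n); rewrite rpredD ?rpredZ //.
    exact: (cW _ _ (leq_maxl m n)) xm.
  exact: (cW _ _ (leq_maxr m n)) yn.
have [s sP] := noethR (comprehension unionP).
have [||n sn] := @directed_seq _ nat 0 (fun n (x : R^o) => x \in c n) _ s.
- move=> m n; exists (maxn m n) => y [ym|yn].
    exact: (cW _ _ (leq_maxl m n)) ym.
  exact: (cW _ _ (leq_maxr m n)) yn.
- by move=> y ys; apply/(mem_comprehension unionP); rewrite sP; apply: mem_gen.
apply: (cS n).2 => x xn; apply: (gen_sub sn).
by rewrite -sP; apply/(mem_comprehension unionP); exists n.+1.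
Qed.

Section Modules.
Variable W : lmodType R.
Implicit Type N : submod W.

Lemma mem_gen_cons (x : W) (s : seq W) z : z \in gen [set y | y \in x :: s] ->
  exists (r : R) y, y \in gen [set y | y \in s] /\ z = r *: x + y.
Proof.
pose P z := exists (r : R) y, y \in gen [set y | y \in s] /\ z = r *: x + y.
have PZD : P 0 /\ forall (c : R) u v, P u -> P v -> P (c *: u + v).
  split=> [|c _ _ [r [y [ys ->]]] [r' [y' [ys' ->]]]].
    by exists 0, 0; rewrite rpred0 scale0r addr0.
  exists (c * r + r'), (c *: y + y'); rewrite rpredD ?rpredZ //; split=> //.
  by rewrite scalerDl scalerDr scalerA addrACA.
move=> zs; apply/(mem_comprehension PZD); apply: gen_sub zs => y ys.
apply/(mem_comprehension PZD); case/predU1P: ys => [->|ys].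
  by exists 1, 0; rewrite rpred0 scale1r addr0.
by exists 0, y; rewrite scale0r add0r; split=> //; exact: mem_gen.
Qed.

Section LeadingCoefficients.
Variables (x : W) (s : seq W) (N : submod W).

(** The coefficients of [x] in the elements of [N], modulo the other generators:
the ideal that drives the induction on the number of generators. *)
Definition leading_coef (r : R^o) : Prop :=
  exists2 y, y \in gen [set y | y \in s] & (r : R) *: x + y \in N.

Fact leading_coef_closed : leading_coef 0 /\ forall (c : R) (r r' : R^o),
  leading_coef r -> leading_coef r' -> leading_coef (c *: r + r').
Proof.
split=> [|c r r' [y ys yN] [y' ys' yN']].
  by exists 0; rewrite ?rpred0 // scale0r addr0 rpred0.
exists (c *: y + y'); first by rewrite rpredD ?rpredZ.
have -> : (c *: r + r' : R) *: x + (c *: y + y') =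
    c *: ((r : R) *: x + y) + ((r' : R) *: x + y').
  by rewrite scalerDl scalerDr scalerA addrACA.
by rewrite rpredD ?rpredZ.
Qed.
End LeadingCoefficients.

(** Induction on the generators. Lifts to [N] of generators of the ideal of
leading coefficients, together with generators of the intersection of [N] with
the span of the remaining generators, generate [N]. *)
Lemma submod_fg_sub_gen (s : seq W) N :
  (forall x, x \in N -> x \in gen [set y | y \in s]) -> submod_fg N.
Proof.
elim: s N => [|x s IH] N Ns.
  exists [::] => z; apply/idP/idP => [/Ns//|]; exact: gen_sub.
have [rs rsP] := noethR (comprehension (leading_coef_closed x s N)).
have /choice[y yP] (r : R^o) : exists w, r \in rs ->
    w \in gen [set y | y \in s] /\ (r : R) *: x + w \in N.
  have [rrs|/negP nrs] := boolP (r \in rs); last by exists 0.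
  have : r \in comprehension (leading_coef_closed x s N).
    by rewrite rsP; exact: mem_gen.
  by move/(mem_comprehension (leading_coef_closed x s N)) => [y ? ?]; exists y.
have capP : (0 \in N /\ 0 \in gen [set y | y \in s]) /\
    forall (c : R) u v, (u \in N /\ u \in gen [set y | y \in s]) ->
    (v \in N /\ v \in gen [set y | y \in s]) ->
    c *: u + v \in N /\ c *: u + v \in gen [set y | y \in s].
  split=> [|c u v [? ?] [? ?]]; first by rewrite !rpred0.
  by rewrite !rpredD ?rpredZ.
have [ss ssP] : submod_fg (comprehension capP).
  by apply: IH => z /(mem_comprehension capP)[].
pose T := gen [set z | z \in [seq (r : R) *: x + y r | r <- rs] ++ ss].
exists ([seq (r : R) *: x + y r | r <- rs] ++ ss) => z.
have TN : forall z, z \in T -> z \in N.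
  apply: gen_sub => v /=; rewrite mem_cat => /orP[/mapP[r rrs ->]|vss].
    by have [] := yP r rrs.
  suff /(mem_comprehension capP)[] : v \in comprehension capP by [].
  by rewrite ssP; exact: mem_gen.
apply/idP/idP => [zN|/TN//].
have [r [w [ws zrw]]] := mem_gen_cons (Ns z zN).
have [w' ws' wT] : leading_coef x s T r.
  apply/(mem_comprehension (leading_coef_closed x s T)).
  have : (r : R^o) \in comprehension (leading_coef_closed x s N).
    by apply/mem_comprehension; exists w => //; rewrite -zrw.
  rewrite rsP; apply: gen_sub => r' rrs; apply/mem_comprehension.
  exists (y r'); first by have [] := yP r' rrs.
  apply: mem_gen => /=; rewrite mem_cat; apply/orP; left.
  by apply/mapP; exists r'.
have -> : z = (w - w') + (r *: x + w') by rewrite zrw addrACA addNr addr0 addrC.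
apply: (rpredD _ wT); have : w - w' \in comprehension capP.
  apply/mem_comprehension; split; last by rewrite rpredB.
  have -> : w - w' = z - (r *: x + w') by rewrite zrw opprD addrACA subrr add0r.
  by apply: rpredB => //; exact: TN.
rewrite ssP; apply: gen_sub => u us; apply: mem_gen => /=.
by rewrite mem_cat us orbT.
Qed.

Lemma submod_fg_noetherian : fg_module W -> forall N, submod_fg N.
Proof.
move=> [s sP] N; apply: (@submod_fg_sub_gen s) => x _.
by rewrite -sP mem_full.
Qed.
End Modules.
End Noetherian.

(** * Products of primes *)

(* Classical equality, needed to speak of membership in a list of primes. *)
HB.instance Definition _ (R : comPzRingType) := gen_eqMixin (spec R).

Section PrimeProducts.
Variable R : comPzRingType.
Implicit Types (I J : ideal R) (L : seq (spec R)).

Definition prime_prod L : ideal R :=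
  foldr (fun (q : spec R) J => ideal_smul q J) (full R^o) L.

Lemma prime_prod_cat L L' : ideal_le (prime_prod (L ++ L'))
  (ideal_smul (prime_prod L) (prime_prod L')).
Proof.
elim: L => [|q L IH] x /=.
  by move=> xL; rewrite -[x](@scale1r _ R^o);
    apply: mem_ideal_smul => //; exact: mem_full.
apply: ideal_smul_sub => r {}x rq /IH xLL; apply/(@mem_colon R R^o).
move: x xLL.
apply: ideal_smul_sub => y z yL zL; apply/(@mem_colon R R^o); rewrite scalerA.
by apply: mem_ideal_smul => //; exact: mem_ideal_smul.
Qed.

Lemma adjoin_closed I (x : R) :
  (exists2 i : R, i \in I & exists r : R, 0 = i + r * x) /\
  forall (c : R) (u v : R^o),
  (exists2 i : R, i \in I & exists r, u = i + r * x) ->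
  (exists2 i : R, i \in I & exists r, v = i + r * x) ->
  exists2 i : R, i \in I & exists r, c *: u + v = i + r * x.
Proof.
split=> [|c _ _ [i iI [r ->]] [j jI [r' ->]]].
  by exists 0; [exact: rpred0|exists 0; rewrite mul0r addr0].
exists (c * i + j); first by apply: (rpredD (V := R^o)) => //; exact: idealMl.
exists (c * r + r').
suff : c * (i + r * x) + (j + r' * x) = c * i + j + (c * r + r') * x by [].
by ring.
Qed.

Definition adjoin I x : ideal R := comprehension (adjoin_closed I x).

Lemma mem_adjoin I x (u : R) :
  u \in adjoin I x <-> exists2 i : R, i \in I & exists r, u = i + r * x.
Proof. exact: (mem_comprehension (adjoin_closed I x)). Qed.

Lemma ideal_lt_adjoin I x : x \notin I -> ideal_lt I (adjoin I x).
Proof.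
move=> xI; split=> [i iI|/(_ x) h].
  by apply/mem_adjoin; exists i => //; exists 0; rewrite mul0r addr0.
move/negP: xI; apply; apply/h/mem_adjoin.
by exists 0; [exact: rpred0|exists 1; rewrite mul1r add0r].
Qed.

(** Noetherian induction on [I]. If [I] is proper and not prime, take x y in [I]
with neither factor in [I]: the product of I + (x) and I + (y) lies in [I], so
the two lists of primes can be concatenated. *)
Lemma prime_prod_sub : noetherian R -> forall I, exists L,
  (forall q, q \in L -> ideal_le I q) /\ ideal_le (prime_prod L) I.
Proof.
move=> noethR; apply: (noetherian_ind noethR) => I IH.
have [I1|I1] := boolP (1 \in I).
  exists [::]; split=> // x _; rewrite -[x]mulr1; exact: idealMl.
have [Iprime|] := pselect (forall x y : R, x * y \in I -> x \in I \/ y \in I).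
  exists [:: Spec I1 Iprime]; split=> [q|x].
    by rewrite inE => /eqP->.
  by apply: ideal_smul_sub => r y rI _; rewrite [_ *: _]mulrC; exact: idealMl.
move=> /existsNP[x /existsNP[y /not_implyP[xyI /not_orP[/negP xI /negP yI]]]].
have [Lx [Lx1 Lx2]] := IH _ (ideal_lt_adjoin xI).
have [Ly [Ly1 Ly2]] := IH _ (ideal_lt_adjoin yI).
exists (Lx ++ Ly); split=> [q|z /prime_prod_cat].
  rewrite mem_cat => /orP[/Lx1 h|/Ly1 h] z zI; apply: h.
    exact: (ideal_lt_adjoin xI).1.
  exact: (ideal_lt_adjoin yI).1.
apply: ideal_smul_sub => u v /Lx2 /mem_adjoin[i iI [r ->]].
move=> /Ly2 /mem_adjoin[j jI [r' ->]].
suff : (i + r * x) * (j + r' * y) \in I by [].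
have -> : (i + r * x) * (j + r' * y) =
  (j + r' * y) * i + (r * x) * j + (r * r') * (x * y) by ring.
by apply: (rpredD (V := R^o)); [apply: (rpredD (V := R^o))|]; exact: idealMl.
Qed.

(** In a product of [size L] elements of [b], each factor is kept where
the corresponding prime contains [b], and multiplied by an element of that prime
outside [p] elsewhere; [u] is the product of these multipliers. *)
Lemma ideal_pow_prime_prod (b : ideal R) (p : spec R) L :
  (forall q, q \in L -> ideal_le b q \/ ~ ideal_le q p) ->
  exists2 u : R, u \notin p &
    forall z : R, z \in ideal_pow b (size L) -> u * z \in prime_prod L.
Proof.
elim: L => [|q L IH] bL; first by
  exists 1; [exact: spec1|move=> *; exact: mem_full].
have [|u up uL] := IH; first by move=> q' qL; apply: bL; rewrite inE qL orbT.
have [bq|qp] := bL q (mem_head q L).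
  exists u => // z zb; apply/(@mem_colon R R^o); move: z zb => /=.
  apply: (@ideal_smul_sub R R^o) => r z rb /uL uzL; apply/(@mem_colon R R^o).
  rewrite scalerA mulrC -scalerA; apply: mem_ideal_smul => //; exact: bq.
have /existsNP[v /not_implyP[vq /negP vp]] := qp.
exists (v * u) => [|z zb].
  by apply/negP => /specM[]; exact/negP.
apply/(@mem_colon R R^o _ (v * u)); move: z zb => /=.
apply: (@ideal_smul_sub R R^o) => r z rb /uL uzL; apply/(@mem_colon R R^o).
rewrite -scalerA; apply: mem_ideal_smul => //.
by rewrite scalerA mulrC -scalerA; exact: idealMl.
Qed.

Lemma minimal_below L (q : spec R) : q \in L -> exists2 q' : spec R,
  q' \in L & ideal_le q' q /\
  forall r : spec R, r \in L -> ideal_le r q' -> ideal_le q' r.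
Proof.
(* Adding [q] to the list lets the induction reach the empty list. *)
suff min (S : seq (spec R)) : exists2 q' : spec R, (q' = q \/ q' \in S) &
    ideal_le q' q /\
    forall r : spec R, r = q \/ r \in S -> ideal_le r q' -> ideal_le q' r.
  move=> qL; have [q' [->|q'L] [q'q q'min]] := min L.
    by exists q => //; split=> // r rL; apply: q'min; right.
  by exists q' => //; split=> // r rL; apply: q'min; right.
elim: S => [|x S [q' q'S [q'q q'min]]].
  by exists q; [left|split=> // r [->|]].
have [xq'|xq'] := pselect (ideal_le x q').
  exists x; first by right; exact: mem_head.
  split=> [z /xq' /q'q //|r [->|/predU1P[->//|rS]] rx z zx].
  - apply: (q'min q (or_introl erefl)); last exact: xq'.
    by move=> w /rx /xq'.
  - apply: (q'min r (or_intror rS)); last exact: xq'.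
    by move=> w /rx /xq'.
exists q'; first by case: q'S => [|h]; [left|right; rewrite inE h orbT].
split=> // r [rq|/predU1P[->|rS]] rq'.
- exact: (q'min r (or_introl rq) rq').
- by case: xq'.
- exact: (q'min r (or_intror rS) rq').
Qed.
End PrimeProducts.

(** * Primes and dimension under quotients and localization *)

Section SpecMap.
Variables (R S : comPzRingType) (f : {rmorphism R -> S}).

Fact comap_closed (J : ideal S) : f 0 \in J /\ forall (c : R) (x y : R^o),
  f x \in J -> f y \in J -> f (c *: x + y) \in J.
Proof.
split=> [|c x y xJ yJ]; first by rewrite rmorph0; exact: rpred0.
rewrite rmorphD [_ *: _]/(c * (x : R)) rmorphM.
by apply: (rpredD (V := S^o)) => //; exact: idealMl.
Qed.

Definition comap (J : ideal S) : ideal R := comprehension (comap_closed J).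

Lemma mem_comap J r : r \in comap J <-> f r \in J.
Proof. exact: (mem_comprehension (comap_closed J)). Qed.

Fact comap_spec1 (P : spec S) : 1 \notin comap P.
Proof.
by apply/negP => /mem_comap; rewrite rmorph1; exact/negP/spec1.
Qed.

Fact comap_specM (P : spec S) (x y : R) :
  x * y \in comap P -> x \in comap P \/ y \in comap P.
Proof.
by move=> /mem_comap; rewrite rmorphM => /specM[];
  [left|right]; exact/mem_comap.
Qed.

Definition comap_spec (P : spec S) : spec R :=
  Spec (comap_spec1 P) (@comap_specM P).

(** When every element of [S] is, up to a unit, in the image of [f], an ideal of
[S] is determined by its preimage, so strict chains of primes pull back to
strict chains. Quotients and localizations are of this kind. *)
Lemma krull_dim_comap :
  (forall s : S, exists (v v' : S) r, v' * v = 1 /\ f r = v * s) ->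
  (krull_dim S <= krull_dim R)%E.
Proof.
move=> fS.
have comap_le (I J : ideal S) : ideal_le (comap I) (comap J) -> ideal_le I J.
  move=> IJ s sI; have [v [v' [r [v'v fr]]]] := fS s.
  have /IJ/mem_comap : r \in comap I.
    by apply/mem_comap; rewrite fr; exact: idealMl.
  by rewrite fr => /(idealMl v'); rewrite mulrA v'v mul1r.
apply: esup_le => _ [l [c [_ cS]] <-]; apply: le_esup; exists l => //.
exists (fun i => comap_spec (c i)); split=> // i /cS[ci cNi].
split=> [r /mem_comap h|/comap_le//]; exact/mem_comap/ci.
Qed.
End SpecMap.

Lemma prime_height_le_krull_dim (R : comPzRingType) (p : spec R) :
  (prime_height p <= krull_dim R)%E.
Proof.
apply: esup_le => _ [l [c [_ cS]] <-]; apply: le_esup; exists l => //.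
by exists c.
Qed.

Lemma ideal_map_sub (R S : comPzRingType) (f : R -> S) (I : ideal R)
    (J : ideal S) :
  (forall x, x \in I -> f x \in J) -> ideal_le (ideal_map f I) J.
Proof. by move=> IJ; apply: (@gen_sub S S^o) => _ [x xI <-]; exact: IJ. Qed.

Lemma mem_ideal_map (R S : comPzRingType) (f : R -> S) (I : ideal R) x :
  x \in I -> f x \in ideal_map f I.
Proof. by move=> xI; apply: mem_gen; exists x. Qed.

Section QuotientSpec.
Variables (R : comPzRingType) (I : ideal R).

Fact quotring_pi_zmod : zmod_morphism (@quotring_pi R I).
Proof.
move=> x y; apply/eqP; rewrite eq_sym subr_eq.
by rewrite -quotring_piD subrK.
Qed.

Fact quotring_pi_monoid : monoid_morphism (@quotring_pi R I).
Proof. by split=> [|x y] //; rewrite -quotring_piM. Qed.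

HB.instance Definition _ :=
  GRing.isZmodMorphism.Build R (quotring I) (@quotring_pi R I) quotring_pi_zmod.
HB.instance Definition _ :=
  GRing.isMonoidMorphism.Build R (quotring I) (@quotring_pi R I)
    quotring_pi_monoid.

Lemma krull_dim_quotring : (krull_dim (quotring I) <= krull_dim R)%E.
Proof.
apply: (@krull_dim_comap _ _ (@quotring_pi R I)) => s.
by exists 1, 1, (repr s); rewrite !mul1r /= quotring_reprK.
Qed.

Section QuotientPrime.
Variables (P : spec R) (IP : ideal_le I P).

Lemma repr_quotring_pi_mem x : repr (quotring_pi I x) \in P <-> x \in P.
Proof.
have xx : repr (quotring_pi I x) - x \in P.
  by apply: IP; apply/quotring_piP; rewrite quotring_reprK.
split=> h.
  have -> : x = repr (quotring_pi I x) - (repr (quotring_pi I x) - x) by ring.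
  exact: (rpredB (V := R^o)).
have -> : repr (quotring_pi I x) = (repr (quotring_pi I x) - x) + x by ring.
exact: (rpredD (V := R^o)).
Qed.

Fact quot_ideal_closed : repr (0 : quotring I) \in P /\
  forall (c : quotring I) (x y : (quotring I)^o),
  repr (x : quotring I) \in P -> repr (y : quotring I) \in P ->
  repr (c *: x + y : quotring I) \in P.
Proof.
split.
  rewrite -(rmorph0 (@quotring_pi R I)); apply/repr_quotring_pi_mem.
  exact: (rpred0 (V := R^o)).
move=> c x y xP yP.
rewrite -[X in repr X]/(c * (x : quotring I) + y).
rewrite -[c]quotring_reprK -[x]quotring_reprK -[y]quotring_reprK.
rewrite -rmorphM -rmorphD; apply/repr_quotring_pi_mem.
by apply: (rpredD (V := R^o)) => //; exact: idealMl.
Qed.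

Definition quot_ideal : ideal (quotring I) := comprehension quot_ideal_closed.

Lemma mem_quot_ideal x : quotring_pi I x \in quot_ideal <-> x \in P.
Proof.
rewrite (mem_comprehension quot_ideal_closed); exact: repr_quotring_pi_mem.
Qed.

Fact quot_spec1 : 1 \notin quot_ideal.
Proof. by apply/negP => /mem_quot_ideal; exact/negP/spec1. Qed.

Fact quot_specM (x y : quotring I) :
  x * y \in quot_ideal -> x \in quot_ideal \/ y \in quot_ideal.
Proof.
rewrite -[x]quotring_reprK -[y]quotring_reprK -rmorphM.
by move=> /mem_quot_ideal/specM[] h; [left|right]; exact/mem_quot_ideal.
Qed.

Definition quot_spec : spec (quotring I) := Spec quot_spec1 quot_specM.

Lemma mem_quot_spec x : quotring_pi I x \in quot_spec <-> x \in P.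
Proof. exact: mem_quot_ideal. Qed.
End QuotientPrime.

(** The primes of a chain starting above [I] all contain [I] and correspond to
primes of R/I. *)
Lemma chain_krull_dim_quotring (l : nat) (c : nat -> spec R) :
  ideal_le I (c 0) ->
  (forall i, (i < l)%N ->
    ideal_le (c i) (c i.+1) /\ ~ ideal_le (c i.+1) (c i)) ->
  (enat l <= krull_dim (quotring I))%E.
Proof.
move=> Ic cS.
(* Freezing the sequence at [l] makes all of its terms contain [I]. *)
have Ici i : ideal_le I (c (minn i l)).
  elim: i => [|i IH]; first by rewrite min0n.
  have [il|li] := ltnP i l; last by move: IH; rewrite !(minn_idPr _) // leqW.
  move=> x /IH; rewrite (minn_idPl (ltnW il)) (minn_idPl il).
  exact: (cS i il).1.
apply: le_esup; exists l => //; exists (fun i => quot_spec (Ici i)).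
split=> // i il; have [] := cS i il.
have e1 := minn_idPl (ltnW il); have e2 := minn_idPl il.
move=> ci cNi; split=> [x|].
  rewrite -[x]quotring_reprK => /mem_quot_spec h; apply/mem_quot_spec.
  by rewrite e2; apply: ci; rewrite -e1.
move=> h; apply: cNi => x xc; rewrite -e1; apply/(mem_quot_spec (Ici i))/h.
by apply/mem_quot_spec; rewrite e2.
Qed.
End QuotientSpec.

Section LocalizationSpec.
Variables (R : comPzRingType) (p : spec R).

Fact loc_inj_zmod : zmod_morphism (@loc_inj R p).
Proof.
move=> x y; apply/eqP; rewrite eq_sym subr_eq; apply/eqP.
by rewrite loc_fracD; apply/loc_fracP; exists (denom1 p); rewrite /=; ring.
Qed.

Fact loc_inj_monoid : monoid_morphism (@loc_inj R p).
Proof.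
split=> [|x y] //; rewrite [RHS]loc_mul_frac.
by apply/loc_fracP; exists (denom1 p); rewrite /=; ring.
Qed.

HB.instance Definition _ :=
  GRing.isZmodMorphism.Build R (locring p) (@loc_inj R p) loc_inj_zmod.
HB.instance Definition _ :=
  GRing.isMonoidMorphism.Build R (locring p) (@loc_inj R p) loc_inj_monoid.

Lemma loc_fracM r s r' s' :
  loc_frac r s * loc_frac r' s' = loc_frac (r * r') (denom_mul s s')
  :> locring p.
Proof. exact: loc_mul_frac. Qed.

Lemma krull_dim_locring : (krull_dim (locring p) <= krull_dim R)%E.
Proof.
apply: (@krull_dim_comap _ _ (@loc_inj R p)) => x.
have [r [s ->]] := loc_fracW x.
exists (loc_inj p (den s)), (loc_frac 1 s), r; rewrite !loc_fracM; split.
  by apply/loc_fracP; exists (denom1 p); rewrite /=; ring.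
by apply/loc_fracP; exists (denom1 p); rewrite /=; ring.
Qed.

Fact loc_ideal_closed (I : ideal R) :
  (exists (r : R) (s : denom p), r \in I /\ (0 : locring p) = loc_frac r s) /\
  forall (c : locring p) (x y : (locring p)^o),
  (exists (r : R) (s : denom p), r \in I /\ x = loc_frac r s) ->
  (exists (r : R) (s : denom p), r \in I /\ y = loc_frac r s) ->
  exists (r : R) (s : denom p),
    r \in I /\ (c *: x + y : locring p) = loc_frac r s.
Proof.
split=> [|c _ _ [r [s [rI ->]]] [r' [s' [rI' ->]]]].
  by exists 0, (denom1 p); split => //; exact: rpred0.
have [v [t ->]] := loc_fracW c.
suff [x [w [xI e]]] : exists (x : R) (w : denom p), x \in I /\
    loc_frac v t * loc_frac r s + loc_frac r' s' = loc_frac x w by exists x, w.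
rewrite loc_fracM loc_fracD; eexists _, _; split; last reflexivity.
by apply: (rpredD (V := R^o)); apply: idealMl => //; exact: idealMl.
Qed.

(** The extension of [I] to the localization, described by numerators instead of
generators. *)
Definition loc_ideal I : ideal (locring p) :=
  comprehension (loc_ideal_closed I).

Lemma mem_loc_ideal I x :
  x \in loc_ideal I <->
  exists (r : R) (s : denom p), r \in I /\ x = loc_frac r s.
Proof. exact: (mem_comprehension (loc_ideal_closed I)). Qed.

Lemma ideal_map_loc_inj I : ideal_le (ideal_map (@loc_inj R p) I) (loc_ideal I).
Proof.
by apply: ideal_map_sub => x xI; apply/mem_loc_ideal; exists x, (denom1 p).
Qed.

Section LocalizationPrime.
Variables (q : spec R) (qp : ideal_le q p).

Lemma den_notin (s : denom p) : den s \notin q.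
Proof. by case: s => s /= /negP sp; apply/negP => /qp. Qed.

Lemma mem_loc_frac r s : loc_frac r s \in loc_ideal q <-> r \in q.
Proof.
split=> [/mem_loc_ideal[r' [s' [rq' /loc_fracP[u e]]]]|rq].
  have : den u * den s' * r \in q by rewrite e; exact: idealMl.
  case/specM=> // /specM[] h; have := den_notin u; have := den_notin s'.
    by rewrite h.
  by rewrite h.
by apply/mem_loc_ideal; exists r, s.
Qed.

Fact loc_spec1 : 1 \notin loc_ideal q.
Proof. by apply/negP => /mem_loc_frac; exact/negP/spec1. Qed.

Fact loc_specM (x y : locring p) :
  x * y \in loc_ideal q -> x \in loc_ideal q \/ y \in loc_ideal q.
Proof.
have [r [s ->]] := loc_fracW x; have [r' [s' ->]] := loc_fracW y.
by rewrite loc_fracM => /mem_loc_frac/specM[] h;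
  [left|right]; exact/mem_loc_frac.
Qed.

Definition loc_spec : spec (locring p) := Spec loc_spec1 loc_specM.

Lemma mem_loc_spec r s : loc_frac r s \in loc_spec <-> r \in q.
Proof. exact: mem_loc_frac. Qed.
End LocalizationPrime.
End LocalizationSpec.

(** * Depth zero *)

Lemma scale_quotmod_pi (R : comPzRingType) (V : lmodType R) (N : submod V)
    (r : R) (x : V) :
  r *: quotmod_pi N x = quotmod_pi N (r *: x).
Proof. exact: quotmod_piZ. Qed.

Lemma quotmod_pi_eq0 (R : comPzRingType) (V : lmodType R) (N : submod V) x :
  quotmod_pi N x = 0 <-> x \in N.
Proof.
have pi0 : quotmod_pi N 0 = 0.
  by apply: (addrI (quotmod_pi N 0)); rewrite -quotmod_piD !addr0.
by rewrite -pi0 quotmod_piP subr0.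
Qed.

(** The first term of a regular sequence would act injectively, while a power of
it kills a given nonzero element. *)
Lemma depth_le0 (R : comPzRingType) (m : ideal R) (W : lmodType R) :
  (forall r (w : W), r \in m -> exists k, r ^+ k *: w = 0) ->
  (exists w : W, w <> 0) -> (depth m W <= enat 0)%E.
Proof.
move=> nilm [w w0]; rewrite /depth; case: ifPn => [/asboolP/(_ w)//|_].
apply: esup_le => _ [[|x s] [sm [sreg _]] <-] //.
case: w0; set Z := ideal_smul (ideal_gen [::]) (full W).
have Z0 y : y \in Z -> y = 0.
  rewrite -{2}[y]scale1r; move: y; apply: scale_eq0_ideal_smul => r y r0 _.
  have -> : r = 0; last by rewrite mulr0 scale0r.
  by apply: (@mem_zero R R^o); apply: (@gen_sub R R^o) r0.
have [k kw] := nilm x w (sm x (mem_head x s)).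
apply: Z0; apply/quotmod_pi_eq0.
have : x ^+ k *: quotmod_pi Z w = 0.
  by rewrite scale_quotmod_pi kw; apply/quotmod_pi_eq0; exact: rpred0.
elim: k {kw} => [|k IH]; first by rewrite scale1r.
by rewrite exprS -scalerA => /(sreg 0 isT)/IH.
Qed.

Section LocalizedModule.
Variables (R : comPzRingType) (p : spec R) (W : lmodType R).

Lemma mfrac_eq0 (w : W) s :
  mfrac w s = 0 :> locmod p W <-> exists u : denom p, den u *: w = 0.
Proof.
rewrite -[0]/(mfrac 0 (denom1 p)) mfracP; split=> -[u e].
  by exists u; rewrite -(scaler0 _ (den u * den s)) -e /= mulr1.
by exists u; rewrite /= mulr1 e scaler0.
Qed.

Lemma scale_mfrac (r : R) s (w : W) t :
  loc_frac r s *: mfrac w t = mfrac (r *: w) (denom_mul s t) :> locmod p W.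
Proof. exact: loc_scale_frac. Qed.

Lemma scale_mfrac_exp (r : R) s (w : W) t k : exists t',
  loc_frac r s ^+ k *: mfrac w t = mfrac (r ^+ k *: w) t' :> locmod p W.
Proof.
elim: k => [|k [t' IH]]; first by exists t; rewrite !scale1r.
exists (denom_mul s t'); rewrite exprS -scalerA IH scale_mfrac.
by rewrite scalerA exprS.
Qed.
End LocalizedModule.

Section Support.
Variables (R : comPzRingType) (W : lmodType R) (p : spec R).

Lemma Supp_witness : Supp W p ->
  exists x : W, forall u : R, u *: x = 0 -> u \in p.
Proof.
move=> [y]; have [x [s ->]] := mfracW y => xs0; exists x => u ux.
apply: contrapT => /negP up; apply: xs0; apply/mfrac_eq0.
by exists (Denom up).
Qed.
End Support.

Lemma ideal_pow_exp (R : comPzRingType) (I : ideal R) r k :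
  r \in I -> r ^+ k \in ideal_pow I k.
Proof.
move=> rI; elim: k => [|k IH]; first exact: mem_full.
by rewrite exprS; apply: (@mem_ideal_smul R R^o).
Qed.

Lemma prime_exp (R : comPzRingType) (p : spec R) (r : R) k :
  r ^+ k \in p -> r \in p.
Proof.
elim: k => [|k IH]; last by rewrite exprS => /specM[].
by have /negP := spec1 p; rewrite expr0.
Qed.

Section Annihilator.
Variables (R : comPzRingType) (W : lmodType R).

Fact annihilator_closed : (forall w : W, (0 : R) *: w = 0) /\
  forall (c : R) (r r' : R^o),
  (forall w : W, (r : R) *: w = 0) -> (forall w : W, (r' : R) *: w = 0) ->
  forall w : W, (c *: r + r' : R) *: w = 0.
Proof.
split=> [w|c r r' rW r'W w]; first by rewrite scale0r.
by rewrite scalerDl -scalerA rW r'W scaler0 addr0.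
Qed.

Definition annihilator : ideal R := comprehension annihilator_closed.

Lemma mem_annihilator (r : R) :
  r \in annihilator <-> forall w : W, r *: w = 0.
Proof. exact: (mem_comprehension annihilator_closed). Qed.

(** If every element had a multiplier outside [p] killing it, finitely many such
multipliers would deal with the generators, and their product would be an
element of the annihilator outside [p]. *)
Lemma fg_module_Supp (p : spec R) : fg_module W -> ideal_le annihilator p ->
  exists w : W, forall u : R, u *: w = 0 -> u \in p.
Proof.
move=> [s sP] annp; apply: contrapT => noW.
have killed (w : W) : exists u : denom p, den u *: w = 0.
  apply: contrapT => nou; apply: noW; exists w => u uw.
  by apply: contrapT => /negP up; apply: nou; exists (Denom up).
have [||u us] := @directed_seq _ _ (denom1 p)
    (fun u (w : W) => den u *: w = 0) _ s.
- move=> u v; exists (denom_mul u v) => w [e|e] /=.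
    by rewrite mulrC -scalerA e scaler0.
  by rewrite -scalerA e scaler0.
- by move=> w _; exact: killed.
have : den u \in p.
  apply/annp/mem_annihilator => w; apply/mem_zero/mem_colon.
  have := mem_full w; rewrite sP; apply: gen_sub => v vs; apply/mem_colon.
  by rewrite (us v vs) rpred0.
by apply/negP; case: u {us}.
Qed.
End Annihilator.

Section DepthZero.
Variables (R : comPzRingType) (M : lmodType R) (p q : spec R).
Hypothesis qp : ideal_le q p.

(** The first hypothesis says that each element of q acts nilpotently on M_q,
the second that M_q is nonzero; both are transported to the localization of M_p
at q R_p. *)
Lemma depth_at_loc_le0 :
  (forall r : R, r \in q -> exists k (u : R),
     u \notin q /\ forall m : M, (u * r ^+ k) *: m = 0) ->
  (exists m : M, forall u : R, u *: m = 0 -> u \in q) ->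
  (depth_at (locmod p M) (loc_spec qp) <= enat 0)%E.
Proof.
move=> nilq [m mq]; apply: depth_le0 => [x w|].
  move=> /ideal_map_loc_inj/mem_loc_ideal[y [s [yq ->]]].
  have [y' [t ->]] := mfracW w; have [m' [t' ->]] := mfracW y'.
  have [r [s' [rq ->]]] := (mem_loc_ideal q y).1 yq.
  have [k [u [uq kill]]] := nilq r rq; exists k.
  have [t1 ->] := scale_mfrac_exp (loc_frac r s') s (mfrac m' t') t k.
  have [t2 ->] := scale_mfrac_exp r s' m' t' k.
  have Uq : loc_inj p u \notin loc_spec qp.
    by apply/negP => /mem_loc_spec; exact/negP.
  apply/mfrac_eq0; exists (Denom Uq).
  rewrite [den _]/(loc_frac u (denom1 p)) scale_mfrac.
  by rewrite scalerA kill; apply/mfrac_eq0; exists (denom1 p); rewrite scaler0.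
exists (mfrac (mfrac m (denom1 p)) (denom1 (loc_spec qp))).
move=> /mfrac_eq0[[U UQ]] /=.
have [v [s Uvs]] := loc_fracW U; rewrite Uvs scale_mfrac => /mfrac_eq0[w].
rewrite scalerA => /mq/specM[|vq]; first by apply/negP; exact: den_notin.
by move/negP: UQ; apply; rewrite Uvs; apply/mem_loc_spec.
Qed.
End DepthZero.

(** Since [a] lies in [p], the prime p R_p / q R_p contains the ideal, and its
height is bounded by the dimension of R_p / q R_p, hence by that of [R]. *)
Lemma height_loc_le (R : comPzRingType) (a : ideal R) (p q : spec R)
    (qp : ideal_le q p) : ideal_le a p ->
  (height (ideal_map (@quotring_pi _ (loc_spec qp))
     (ideal_add (ideal_map (@loc_inj R p) a) (loc_spec qp))) <= krull_dim R)%E.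
Proof.
move=> ap; have pp : ideal_le p p by [].
have QP : ideal_le (loc_spec qp) (loc_spec pp).
  move=> x; have [r [s ->]] := loc_fracW x => /mem_loc_spec/qp rp.
  exact/mem_loc_spec.
apply: (@le_trans _ _ (prime_height (quot_spec QP))).
  apply: einf_le; exists (quot_spec QP) => //=.
  apply: ideal_map_sub => x xaQ; apply/mem_quot_spec; move: x xaQ.
  apply: (@gen_sub _ (locring p)^o) => x [|/QP//].
  by apply: ideal_map_sub => r /ap rp; apply/mem_loc_spec.
apply: le_trans (prime_height_le_krull_dim _) _.
exact: le_trans (krull_dim_quotring _) (krull_dim_locring _).
Qed.

(** * Annihilators act trivially on local cohomology *)

Section InjectiveExtension.
Variables (R : comPzRingType) (A B I : lmodType R).
Variables (d : {linear A -> B}) (g : {linear A -> I}).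
Hypothesis injI : injective_module I.
Hypothesis kerdg : forall x, d x = 0 -> g x = 0.

Fact image_closed : (exists x, d x = 0) /\ forall (c : R) y y',
  (exists x, d x = y) -> (exists x, d x = y') -> exists x, d x = c *: y + y'.
Proof.
split=> [|c _ _ [x <-] [x' <-]]; first by exists 0; rewrite linear0.
by exists (c *: x + x'); rewrite linearP.
Qed.

Definition image_submod : submod B := comprehension image_closed.

Let preimage_ex (y : submodule image_submod) : exists x, d x = val y.
Proof. exact/(mem_comprehension image_closed)/(valP y). Qed.

Let lift (y : submodule image_submod) : I := g (sval (cid (preimage_ex y))).

Let lift_eq y x : d x = val y -> lift y = g x.
Proof.
rewrite /lift; case: cid => x' /= <- e; apply/eqP; rewrite -subr_eq0 -linearB.
by apply/eqP/kerdg; rewrite linearB e subrr.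
Qed.

Let lift_linear : linear lift.
Proof.
move=> c y y'; have [x xy] := preimage_ex y; have [x' xy'] := preimage_ex y'.
rewrite (lift_eq xy) (lift_eq xy') -linearP; apply: lift_eq.
by rewrite linearP xy xy'.
Qed.

(** [g] factors through the image of [d], a submodule of [B], and extends from
there by injectivity. *)
Lemma injective_extension : exists h : {linear B -> I}, forall x, h (d x) = g x.
Proof.
pose L := GRing.isLinear.Build R _ _ _ lift lift_linear.
pose liftL : {linear submodule image_submod -> I} := HB.pack lift L.
pose incl : {linear submodule image_submod -> B} := val.
have [h hP] := injI (f := incl) liftL val_inj.
exists h => x; have dx : d x \in image_submod.
  by apply/(mem_comprehension image_closed); exists x.
rewrite -[d x](SubK (submodule image_submod) dx) hP /=.
by apply: lift_eq; rewrite SubK.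
Qed.
End InjectiveExtension.

Section ResolutionHomotopy.
Variables (R : comPzRingType) (M : lmodType R) (E : injective_resolution M).
Variable r : R.
Hypothesis rM : forall m : M, r *: m = 0.

(** Multiplication by [r] lifts the zero map of [M] to the resolution, hence is
homotopic to zero; [h] is one component of the homotopy, of which only the
effect on cocycles is recorded. The next component extends r - d h, which
vanishes on cocycles. *)
Lemma annihilator_homotopy i : exists h : {linear ir_obj E i.+1 -> ir_obj E i},
  forall z, ir_d E i.+1 z = 0 -> ir_d E i (h z) = r *: z.
Proof.
elim: i => [|i [h hP]].
  pose g : {linear ir_obj E 0 -> ir_obj E 0} := GRing.scale r.
  have [|h hP] := @injective_extension _ _ _ _ (ir_d E 0) g
    (@ir_injective _ _ E 0).
    move=> x /ir_exact0[m <-] /=.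
    by rewrite -linearZ rM linear0.
  by exists h => _ /ir_exact[y <-]; rewrite hP linearZ.
pose g : {linear ir_obj E i.+1 -> ir_obj E i.+1} :=
  GRing.scale r \- (ir_d E i \o h).
have [|h' h'P] := @injective_extension _ _ _ _ (ir_d E i.+1) g
  (@ir_injective _ _ E i.+1).
  by move=> x /hP /= ->; rewrite subrr.
exists h' => _ /ir_exact[w <-]; rewrite h'P /= linearB linearZ.
suff -> : ir_d E i.+1 (ir_d E i (h w)) = 0 by rewrite subr0.
by apply/ir_exact; exists (h w).
Qed.
End ResolutionHomotopy.

Section LocalCohomologyActions.
Variables (R : comPzRingType) (a : ideal R) (M : lmodType R).
Variable E : injective_resolution M.

Local Notation GE := (fun i => Gamma a (ir_obj E i)).
Local Notation Gd := (fun i => Gamma_map (ir_d E i)).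

Lemma local_cohomology_cocycle i (x : local_cohomology a E i) :
  exists z : @cocycles R GE Gd i,
    forall r : R, @coboundary_pred R GE Gd i (r *: z) -> r *: x = 0.
Proof.
exists (repr x) => r rx.
exact: (quotmod_pi_eq0 (Submod (@coboundary_closed R GE Gd i)) _).2 rx.
Qed.

Lemma local_cohomology_torsion i (x : local_cohomology a E i) :
  exists t, forall r, r \in ideal_pow a t -> r *: x = 0.
Proof.
have [z zx] := local_cohomology_cocycle x.
have /asboolP[t zt] := valP (val z); exists t => r /zt rz; apply: zx.
suff -> : r *: z = 0 by exact: (coboundary_closed _ _).1.
by apply/val_inj/val_inj.
Qed.

(** The homotopy is linear, so it preserves torsion and survives the passage to
the torsion subcomplex. *)
Lemma annihilator_local_cohomology r : (forall m : M, r *: m = 0) ->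
  forall i (x : local_cohomology a E i), r *: x = 0.
Proof.
move=> rM [|i] x; have [z zx] := local_cohomology_cocycle x;
  apply/zx/asboolP.
  have /asboolP/(congr1 val) /= /ir_exact0[m me] := valP z.
  by apply: val_inj; rewrite /= -me -linearZ rM linear0.
have /asboolP/(congr1 val) /= dz := valP z.
have [h hP] := annihilator_homotopy E rM i.
exists (Gamma_map h (val z)); apply: val_inj => /=; exact: hP.
Qed.

(** Cocycles of degree 0 are the torsion elements of [M], and finitely many
generators of the torsion of [M] share an exponent. *)
Lemma local_cohomology0_kill : noetherian R -> fg_module M ->
  exists t, forall r, r \in ideal_pow a t ->
  forall x : local_cohomology a E 0, r *: x = 0.
Proof.
move=> noethR fgM; have [s sP] := submod_fg_noetherian noethR fgM (torsion a M).
have [||t st] := @directed_seq _ _ 0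
    (fun t (m : M) => forall r, r \in ideal_pow a t -> r *: m = 0) _ s.
- move=> k l; exists (maxn k l) => m [h|h] r rkl; apply: h.
    exact: ideal_pow_le (leq_maxl k l) _ rkl.
  exact: ideal_pow_le (leq_maxr k l) _ rkl.
- move=> m ms; have : m \in torsion a M by rewrite sP; exact: mem_gen.
  by move=> /asboolP.
exists t => r rt x; have [z zx] := local_cohomology_cocycle x.
apply/zx/asboolP.
have /asboolP/(congr1 val) /= /ir_exact0[m me] := valP z.
have mtor : m \in torsion a M.
  have /asboolP[k zk] := valP (val z); apply/asboolP; exists k => c /zk cz.
  by apply: (@ir_aug_inj _ _ E); rewrite linearZ linear0 me.
apply: val_inj; rewrite /= -me -linearZ.
suff -> : r *: m = 0 by rewrite linear0.
apply/mem_zero/mem_colon; move: mtor; rewrite sP; apply: gen_sub => y ys.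
by apply/mem_colon; rewrite (st y ys r rt) rpred0.
Qed.

End LocalCohomologyActions.

(** * Supports and the two invariants *)

Lemma Supp_ideal_smul_kill (R : comPzRingType) (W : lmodType R) (I : ideal R)
    (u : R) (p : spec R) :
  (forall r, r \in I -> forall x : W, (u * r) *: x = 0) ->
  Supp (submodule (ideal_smul I (full W))) p -> u \in p.
Proof.
move=> uI /Supp_witness[x]; apply; apply: val_inj.
by apply: (scale_eq0_ideal_smul _ (valP x)) => r y rI _; exact: uI.
Qed.

Lemma Supp_torsion (R : comPzRingType) (W : lmodType R) (a : ideal R)
    (N : submod W) (p : spec R) :
  (forall x : W, exists t, forall r, r \in ideal_pow a t -> r *: x = 0) ->
  Supp (submodule N) p -> ideal_le a p.
Proof.
move=> tor /Supp_witness[x xp] r ra; have [t xt] := tor (val x).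
apply: (@prime_exp _ _ _ t); apply: xp; apply: val_inj.
exact/xt/ideal_pow_exp.
Qed.

(** The prime q R_p of R_p contributes to the infimum over R_p: its depth term
vanishes and its height term is at most dim R. *)
Lemma lambda_n_le (R : comPzRingType) (a b : ideal R) (M : lmodType R) (n : nat)
    (p q : spec R) :
  ideal_le q p -> ideal_le a p -> ~ ideal_le b q ->
  (enat n <= krull_dim (quotring p))%E ->
  (forall r : R, r \in q -> exists k (u : R),
     u \notin q /\ forall m : M, (u * r ^+ k) *: m = 0) ->
  (exists m : M, forall u : R, u *: m = 0 -> u \in q) ->
  (lambda_n a b M n <= krull_dim R)%E.
Proof.
move=> qp ap bq np nilq qsupp.
apply: (@le_trans _ _ (lambda (ideal_map (@loc_inj R p) a)
   (ideal_map (@loc_inj R p) b) (locmod p M))).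
  by apply: einf_le; exists p.
apply: (@le_trans _ _ (depth_at (locmod p M) (loc_spec qp) +
   height (ideal_map (@quotring_pi _ (loc_spec qp))
     (ideal_add (ideal_map (@loc_inj R p) a) (loc_spec qp))))%E).
  apply: einf_le; exists (loc_spec qp) => //= bQ; apply: bq => r rb.
  by apply/(mem_loc_spec qp r (denom1 p))/bQ/mem_ideal_map.
rewrite -[leRHS]add0e; apply: leeD; first exact: depth_at_loc_le0.
exact: height_loc_le.
Qed.

(** The power [t = size L] decides, where [L] lists primes over Ann M whose
product annihilates [M]: a prime in the support of b^t H^i has to contain
a prime of [L] that does not contain [b], and [M] has depth 0 at a minimal such
prime. *)
Lemma lambda_n_le_of_Supp (R : comPzRingType) (noethR : noetherian R)
    (a b : ideal R) (M : lmodType R) (fgM : fg_module M)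
    (E : injective_resolution M) (i n : nat) :
  (forall t, (enat n <= dim_set (Supp (submodule
     (ideal_smul (ideal_pow b t) (full (local_cohomology a E i))))))%E) ->
  (lambda_n a b M n <= krull_dim R)%E.
Proof.
move=> /= dimS; have [L [annL Lann]] := prime_prod_sub noethR (annihilator M).
have [l [c [cS cl]] nl] := esup_enat_witness (dimS (size L)).
have pS := cS 0 (leq0n l); set p := c 0 in pS.
have ap : ideal_le a p := Supp_torsion (@local_cohomology_torsion _ a M E i) pS.
have np : (enat n <= krull_dim (quotring p))%E.
  apply: le_trans (chain_krull_dim_quotring _ cl); first by rewrite le_enat.
  by [].
have [q0 q0L [bq0 q0p]] : exists2 q : spec R, q \in L &
    ~ ideal_le b q /\ ideal_le q p.
  (* Otherwise some [u] outside [p] kills b^t H^i. *)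
  apply: contrapT => noq.
  have [|u /negP up uL] := @ideal_pow_prime_prod _ b p L.
    move=> q qL; have [bq|bq] := pselect (ideal_le b q); [by left|right=> qp].
    by apply: noq; exists q.
  apply/up/(Supp_ideal_smul_kill _ pS) => r /uL /Lann /mem_annihilator urM x.
  exact: (annihilator_local_cohomology (i := i) urM x).
have [q qL [qq0 qmin]] := minimal_below q0L.
(* By minimality of [q], each prime of [L] contains [q] or escapes it. *)
have [|u uq uL] := @ideal_pow_prime_prod _ q q L.
  move=> r rL; have [rq|rq] := pselect (ideal_le r q); [left|by right].
  exact: qmin.
apply: (@lambda_n_le _ _ _ _ _ p q) => //.
- by move=> x /qq0 /q0p.
- by move=> bq; apply: bq0 => x /bq /qq0.
- move=> r rq; exists (size L), u; split=> //.
  exact/mem_annihilator/Lann/uL/ideal_pow_exp.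
- exact: fg_module_Supp fgM (annL q qL).
Qed.

Lemma ideal_pow_mono (R : comPzRingType) (a b : ideal R) t :
  ideal_le b a -> ideal_le (ideal_pow b t) (ideal_pow a t).
Proof.
move=> ba; elim: t => [//|t IH] r /=.
apply: (@ideal_smul_sub R R^o) => s y /ba sa yt.
by apply: (@mem_ideal_smul R R^o) => //; exact: IH.
Qed.

Lemma Supp_ideal_pow_local_cohomology0 (R : comPzRingType)
    (noethR : noetherian R) (a b : ideal R) (ba : ideal_le b a)
    (M : lmodType R) (fgM : fg_module M) (E : injective_resolution M) :
  exists t, forall p : spec R, ~ Supp (submodule
    (ideal_smul (ideal_pow b t) (full (local_cohomology a E 0)))) p.
Proof.
have [t tP] := local_cohomology0_kill a E noethR fgM; exists t => p Sp.
have : 1 \in p.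
  apply: Supp_ideal_smul_kill Sp => r rb x; rewrite mul1r.
  exact/tP/(ideal_pow_mono ba).
exact/negP/spec1.
Qed.

Theorem corollary1p6 (R : comPzRingType) (noethR : noetherian R)
    (dimR : (krull_dim R <= enat 2)%E)
    (a b : ideal R) (ba : ideal_le b a)
    (M : lmodType R) (fgM : fg_module M)
    (E : injective_resolution M) (n : nat) :
  (lambda_n a b M n - 1 <= f_n a b E n)%E.
Proof.
apply: le_einf => _ [i iS <-].
have lam2 : (lambda_n a b M n <= enat 2)%E.
  exact: le_trans (lambda_n_le_of_Supp noethR fgM iS) dimR.
case: i iS => [iS|i _].
  have [t noS] := Supp_ideal_pow_local_cohomology0 noethR ba fgM E.
  have [l [c [cS _]] _] := esup_enat_witness (iS t).
  by case: (noS (c 0)); exact: cS.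
apply: (@le_trans _ _ (enat 1)); last by rewrite le_enat.
by rewrite leeBlDr.
Qed.
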